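(* Let $a$ and $b$ be positive integers such that $b$ divides $a$, and let $q\in\mathbb{Q}$ be a rational number. Then $l(q)\in\mathbb{Z}$ if and only if \[q\in\Bigl\{\frac{F_i}{F_{i+1}},\ \frac{L_i}{L_{i+1}},\ -\frac{L_{i+1}}{bL_i}\Bigr\}_{i\in\mathbb{N}}\quad\text{or}\quad q\in\Bigl\{-\frac{F_{i+1}}{bF_i}\Bigr\}_{i\in\mathbb{N}^{+}}.\]
   Context: Here $\mathbb{N}=\{0,1,2,\dots\}$ and $\mathbb{N}^{+}=\{1,2,3,\dots\}$. For positive integers $a,b$, the integer sequences $\{F_i\}_{i\in\mathbb{N}}$ and $\{L_i\}_{i\in\mathbb{N}}$ are defined by $F_0=0$, $F_1=1$, $F_{i+2}=aF_{i+1}+bF_i$, and $L_0=2$, $L_1=a$, $L_{i+2}=aL_{i+1}+bL_i$, for $i\in\mathbb{N}$. The generating function of $\{L_i\}$ is taken to be the rational function \[l(t)=\frac{2-at}{1-at-bt^2},\] evaluated at rational $t$ (no convergence condition is imposed). *)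

(* Defs.v *)
From mathcomp Require Import all_boot all_order all_algebra.

Set Implicit Arguments.
Unset Strict Implicit.
Unset Printing Implicit Defensive.

Import Order.TTheory GRing.Theory Num.Theory.
Local Open Scope ring_scope.

Fixpoint F (a b : int) (i : nat) : int :=
  match i with
  | 0 => 0
  | 1 => 1
  | (j.+1 as k).+1 => a * F a b k + b * F a b j
  end.

Fixpoint L (a b : int) (i : nat) : int :=
  match i with
  | 0 => 2
  | 1 => a
  | (j.+1 as k).+1 => a * L a b k + b * L a b j
  end.

(* Pitfall: MathComp division gives l a b t = 0 where the denominator vanishes.
   If a, b > 0 and b divides a, then a ^+ 2 + 4 * b is not a square, so the
   denominator has no rational root. *)
Definition l (a b : int) (t : rat) : rat :=
  (2 - a%:~R * t) / (1 - a%:~R * t - b%:~R * t ^+ 2).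

(* Main.v *)
Require Import Defs.
From mathcomp Require Import all_boot all_order all_algebra.
From mathcomp Require Import zify ring.

Import Order.TTheory GRing.Theory Num.Theory.
Local Open Scope ring_scope.

(** Write [a = b c].  For an integer [n = 1 + m], the equation [l q = n] says
    that [q] is a root of

      [(1 + m) b q^2 + m a q + (1 - m) = 0],

    provided the denominator of [l] has no rational root, which holds because
    [b] divides [a].  Multiplying by [(1 + m) b] shows that [z = - n b q] is a
    rational root of a monic integral quadratic, so it is an integer with

      [z (z - a m) = b (m^2 - 1)].

    This is a Pell equation in disguise: with [s = 2 z - a m] it becomes
    [s^2 = (a^2 + 4 b) m^2 - 4 b].  The substitution
    [(m, z) |-> (m - c (z - a m), z - a m)] preserves it and decreases [m] as
    long as [1 < m] and [0 < z]; hence every solution descends to [m = 1], and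
    running the descent backwards produces the numbers [F_(2i+1) / b^i]
    ([pell_descent], [pell_odd_F]).  Therefore
    [m = F_(2i+1) / (-b)^i] or [m = - F_(2i+1) / (-b)^i] for some [i].

    For those two values of [m] the quadratic splits over the rationals: up to
    a nonzero factor it is [(F_(i+1) q - F_i) (b L_i q + L_(i+1))] in the
    first case and [(L_(i+1) q - L_i) (b F_i q + F_(i+1))] in the second
    ([l_eq_F], [l_eq_L]), by the identities expressing [F_(i+1) L_i],
    [F_i L_(i+1)] and [F_(i+1) L_(i+1) - b F_i L_i] through [F_(2i+1)].  The
    roots are the four families of the theorem; the last one starts at
    [i = 1] because its linear factor is the constant [1] for [i = 0].
    Conversely [b^i] divides [F_(2i+1)] ([F_odd_dvd]), so every index [i] does
    give two integers [m], and all these roots do make [l q] an integer. *)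

(** * Identities for the two sequences *)

Lemma FSS (a b : int) (i : nat) :
  F a b i.+2 = a * F a b i.+1 + b * F a b i.
Proof. by []. Qed.

Lemma LSS (a b : int) (i : nat) :
  L a b i.+2 = a * L a b i.+1 + b * L a b i.
Proof. by []. Qed.

Lemma F_pos (a b : int) (i : nat) : 0 < a -> 0 < b -> 0 < F a b i.+1.
Proof.
move=> ha hb; suff: 0 <= F a b i /\ 0 < F a b i.+1 by case.
elim: i => [//|i [IH0 IH1]]; split; first exact: ltW.
by rewrite FSS ltr_pwDl ?mulr_gt0 // mulr_ge0 // ltW.
Qed.

Lemma L_pos (a b : int) (i : nat) : 0 < a -> 0 < b -> 0 < L a b i.
Proof.
move=> ha hb; suff: 0 < L a b i /\ 0 < L a b i.+1 by case.
elim: i => [//|i [IH0 IH1]]; split => //.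
by rewrite LSS addr_gt0 ?mulr_gt0.
Qed.

(** The pair carries the induction: the first equation at [i + 1] comes from
    the second at [i], and the second at [i + 1] from both. *)
Lemma L_F (a b : int) (i : nat) :
  L a b i = 2 * F a b i.+1 - a * F a b i
  /\ L a b i.+1 = a * F a b i.+1 + 2 * b * F a b i.
Proof.
elim: i => [|i [IH0 IH1]]; first by rewrite /=; split; ring.
by split; rewrite ?LSS ?FSS ?IH0 ?IH1; ring.
Qed.

Lemma F_double (a b : int) (i : nat) :
  F a b i.*2.+1 = F a b i.+1 ^+ 2 + b * F a b i ^+ 2
  /\ F a b i.*2.+2 = F a b i.+1 * (a * F a b i.+1 + 2 * b * F a b i).
Proof.
elim: i => [|i [IH0 IH1]]; first by rewrite /=; split; ring.
by rewrite doubleS (FSS a b i.*2.+2) (FSS a b i.*2.+1) IH0 IH1 FSS; split; ring.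
Qed.

Lemma F_cassini (a b : int) (i : nat) :
  F a b i.+1 ^+ 2 - a * F a b i * F a b i.+1 - b * F a b i ^+ 2 = (- b) ^+ i.
Proof.
elim: i => [|i IH]; first by rewrite /=; ring.
by rewrite [RHS]exprS -IH FSS; ring.
Qed.

Lemma FL_next (a b : int) (i : nat) :
  F a b i.+1 * L a b i = F a b i.*2.+1 + (- b) ^+ i.
Proof.
by rewrite (L_F a b i).1 (F_double a b i).1 -(F_cassini a b i); ring.
Qed.

Lemma FL_prev (a b : int) (i : nat) :
  F a b i * L a b i.+1 = F a b i.*2.+1 - (- b) ^+ i.
Proof.
by rewrite (L_F a b i).2 (F_double a b i).1 -(F_cassini a b i); ring.
Qed.

Lemma FL_cross (a b : int) (i : nat) :
  F a b i.+1 * L a b i.+1 - b * (F a b i * L a b i) = a * F a b i.*2.+1.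
Proof.
by rewrite (L_F a b i).2 (L_F a b i).1 (F_double a b i).1; ring.
Qed.

(** * Divisibility of the odd-indexed terms *)

(** The quotients [u] and [v] satisfy a recurrence with integer coefficients,
    [u' = a v + u] and [v' = c u' + v]; integrality of [v'] is where
    [b %| a] enters. *)
Lemma F_odd_dvd (b c : int) (i : nat) :
  exists u v : int, u * b ^+ i = F (b * c) b i.*2.+1
    /\ v * b ^+ i.+1 = F (b * c) b i.*2.+2.
Proof.
elim: i => [|i [u [v [hu hv]]]].
  by exists 1, c; rewrite /=; split; ring.
exists (b * c * v + u), (c * (b * c * v + u) + v).
rewrite doubleS (FSS _ _ i.*2.+2) (FSS _ _ i.*2.+1) -hv -hu.
by rewrite !exprS; split; ring.
Qed.

(** * The Pell equation *)

(** Infinite descent on [u], along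
    [(u, z) |-> (u', z') = (u - c z', z - a u)] with [a = b c].  When [1 < u],
    the equation [z z' = b (u^2 - 1)] makes [z'] positive, and
    [b c u < z] then forces [b c u z' < z z' < b u^2], that is [c z' < u].  So
    positivity survives and [u' < u].  The inverse step is the recurrence of
    the quotients of [F] by powers of [b] in [F_odd_dvd]. *)
Lemma pell_descent (b c : int) : 0 < b -> 0 < c ->
  forall u z : int, 0 < u -> 0 < z ->
    z * (z - b * c * u) = b * (u ^+ 2 - 1) ->
  exists i : nat, b ^+ i * u = F (b * c) b i.*2.+1
    /\ b ^+ i * z = F (b * c) b i.*2.+2.
Proof.
move=> hb hc u; move: {2}(`|u|%N) (leqnn `|u|%N) => n.
elim: n u => [|n IH] u hn z hu hz e; first by lia.
have [u1|u1] := eqVneq u 1.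
  exists 0%N; rewrite u1 in e *; split; first by rewrite /=; ring.
  move/eqP: e; rewrite mulr1 expr1n subrr mulr0 mulf_eq0 (gt_eqF hz) /=.
  by rewrite subr_eq0 => /eqP ->; rewrite /=; ring.
pose z' := z - b * c * u; pose u' := u - c * z'.
have ez : z = z' + b * c * u by rewrite /z'; ring.
have eu : u = u' + c * z' by rewrite /u'; ring.
have hz' : 0 < z'.
  have : 0 < z * z' by rewrite e mulr_gt0 //; nia.
  by rewrite pmulr_rgt0.
have hu' : 0 < u'.
  have h1 : b * c * u * z' < b * u * u.
    have : b * c * u * z' < z * z' by rewrite ltr_pM2r //; lia.
    by rewrite e; nia.
  have : (b * u) * (c * z') < (b * u) * u by lia.
  by rewrite ltr_pM2l ?mulr_gt0 // /u' subr_gt0.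
have lt : u' < u by rewrite eu ltrDl mulr_gt0.
have [||||i [h1 h2]] := IH u' _ z' => //; first by lia.
  by rewrite /u' /z'; lia.
exists i.+1; rewrite doubleS (FSS _ _ i.*2.+2) (FSS _ _ i.*2.+1) -h1 -h2 ez eu.
by rewrite !exprS; split; ring.
Qed.

(** All solutions reduce to the ones with both entries positive by the
    symmetries [(u, z) |-> (- u, - z)] and [z |-> a u - z], the second one
    exchanging the two roots of the quadratic in [z]. *)
Lemma pell_odd_F (b c : int) : 0 < b -> 0 < c ->
  forall u z : int, z * (z - b * c * u) = b * (u ^+ 2 - 1) ->
  exists i : nat, u * (- b) ^+ i = F (b * c) b i.*2.+1
    \/ u * (- b) ^+ i = - F (b * c) b i.*2.+1.
Proof.
move=> hb hc.
have pos u z : 0 < u -> z * (z - b * c * u) = b * (u ^+ 2 - 1) ->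
  exists i : nat, b ^+ i * u = F (b * c) b i.*2.+1.
  move=> hu e; have [hz|hz] := ltP 0 z.
    by have [i [h _]] := pell_descent b c hb hc u z hu hz e; exists i.
  have hz' : 0 < b * c * u - z by have := mulr_gt0 (mulr_gt0 hb hc) hu; lia.
  have [|i [h _]] := pell_descent b c hb hc u _ hu hz'; last by exists i.
  by rewrite -e; ring.
have sgn i : (- b) ^+ i = b ^+ i \/ (- b) ^+ i = - b ^+ i.
  by rewrite exprNn -signr_odd; case: (odd i); rewrite /= ?mul1r ?mulN1r; auto.
move=> u z e; case: (ltrgtP u 0) => hu.
- have [||i h] := pos (- u) (- z).
  + by rewrite oppr_gt0.
  + by rewrite sqrrN -e; ring.
  + by exists i; rewrite -h; case: (sgn i) => ->; [right|left]; ring.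
- have [i h] := pos u z hu e.
  by exists i; rewrite -h; case: (sgn i) => ->; [left|right]; ring.
- by move: e; rewrite hu => e; nia.
Qed.

(** * From rational roots to the Pell equation *)

(** The rational root theorem for a monic quadratic: the denominator divides
    the square of the numerator, to which it is coprime. *)
Lemma rat_quadratic_int (x : rat) (A B : int) :
  x * (x + A%:~R) = B%:~R -> exists z : int, x = z%:~R.
Proof.
move=> e; apply/intrP; rewrite Qint_def.
have eZ : numq x * numq x = denq x * (B * denq x - A * numq x).
  apply: (@intr_inj rat); rewrite !(rmorphM, rmorphB) /= -e.
  by rewrite numqE; ring.
have cop : coprimez (denq x) (numq x).
  by rewrite /coprimez /gcdz gcdnC; have := coprime_num_den x.
have : (denq x %| numq x * numq x)%Z by rewrite eZ dvdz_mulr.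
rewrite Gauss_dvdzr // => h.
move: cop; rewrite /coprimez => /eqP cop.
have : (denq x %| gcdz (denq x) (numq x))%Z by rewrite dvdz_gcd dvdzz h.
by rewrite cop dvdz1 => /eqP h1; have := denq_gt0 x; lia.
Qed.

(** A rational root [q] would make [z = b q] an integer with
    [z (z + b c) = b].  Up to exchanging [z] with [- z - b c] one has
    [0 < z], and then the left-hand side exceeds [b]. *)
Lemma denominator_neq0 (b c : int) (q : rat) : 0 < b -> 0 < c ->
  1 - (b * c)%:~R * q - b%:~R * q ^+ 2 != 0 :> rat.
Proof.
move=> hb hc; apply/eqP => e.
have e2 : b%:~R * q * (b%:~R * q + (b * c)%:~R) = b%:~R :> rat.
  apply/eqP; rewrite -subr_eq0.
  have -> : b%:~R * q * (b%:~R * q + (b * c)%:~R) - b%:~R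
    = - b%:~R * (1 - (b * c)%:~R * q - b%:~R * q ^+ 2) by ring.
  by rewrite e mulr0.
have [z hz] := rat_quadratic_int _ _ _ e2.
move: e2; rewrite hz -rmorphD -rmorphM /= => /intr_inj e2.
have noroot (y : int) : 0 < y -> y * (y + b * c) <> b.
  move=> hy; have : b * 1 <= b * (y * c) by rewrite ler_pM2l //; nia.
  by have := mulr_gt0 hy hy; lia.
have [h|h] := ltP 0 z; first exact: noroot h e2.
apply: (noroot (- z - b * c)); last by lia.
have : 0 < (- z) * (- z - b * c) by lia.
by nia.
Qed.

Lemma l_eq (b c n : int) (q : rat) : 0 < b -> 0 < c ->
  l (b * c) b q = n%:~R <->
  n%:~R * (1 - (b * c)%:~R * q - b%:~R * q ^+ 2) = 2 - (b * c)%:~R * q.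
Proof.
move=> hb hc; have h := denominator_neq0 b c q hb hc; rewrite /l.
by split=> [<-|<-]; rewrite ?divfK ?mulfK.
Qed.

(** The integer fed to the Pell equation is [z = - n b q]; this [z] solves it
    even though [n q] itself is not yet known to be an integer. *)
Lemma l_int_odd_F (b c n : int) (q : rat) : 0 < b -> 0 < c ->
  l (b * c) b q = n%:~R ->
  exists i : nat, (n - 1) * (- b) ^+ i = F (b * c) b i.*2.+1
    \/ (n - 1) * (- b) ^+ i = - F (b * c) b i.*2.+1.
Proof.
move=> hb hc /(l_eq b c n q hb hc) e.
have ez : - (n%:~R * b%:~R * q)
    * (- (n%:~R * b%:~R * q) + (- (b * c * (n - 1)))%:~R)
    = (b * ((n - 1) ^+ 2 - 1))%:~R :> rat.
  apply/eqP; rewrite -subr_eq0; apply/eqP.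
  transitivity (n%:~R * b%:~R * ((2 - (b * c)%:~R * q)
    - n%:~R * (1 - (b * c)%:~R * q - b%:~R * q ^+ 2)) : rat); first by ring.
  by rewrite e subrr mulr0.
have [z hz] := rat_quadratic_int _ _ _ ez.
apply: (pell_odd_F b c hb hc (n - 1) z).
by move: ez; rewrite hz -rmorphD -rmorphM /= => /intr_inj.
Qed.

(** * Factorization of the quadratic *)

(** Multiplied by [B], the quadratic has the coefficients of
    [- (f' q - f) (b g q + g')], by the three relations.  Keeping [B] as a
    common denominator covers both signs of [m]: one takes
    [(f, g) = (F, L)] for one sign and [(f, g) = (L, - F)] for the other. *)
Lemma quadratic_factor (K : fieldType) (a b m B f f' g g' q : K) : B != 0 ->
  f' * g = m * B + B -> f * g' = m * B - B ->
  f' * g' - b * (f * g) = a * (m * B) ->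
  (1 + m) * (1 - a * q - b * q ^+ 2) = 2 - a * q <->
  (f' * q - f = 0) \/ (b * g * q + g' = 0).
Proof.
move=> nB e1 e2 e3.
have e : ((1 + m) * (1 - a * q - b * q ^+ 2) - (2 - a * q)) * B
    = - ((f' * q - f) * (b * g * q + g')).
  have -> : ((1 + m) * (1 - a * q - b * q ^+ 2) - (2 - a * q)) * B
    = (m * B - B) - a * (m * B) * q - (m * B + B) * (b * q ^+ 2) by ring.
  by rewrite -e1 -e2 -e3; ring.
split=> [h|h].
  move/eqP: e; rewrite h subrr mul0r eq_sym oppr_eq0 mulf_eq0.
  by case/orP => /eqP; [left|right].
have z : (f' * q - f) * (b * g * q + g') = 0 by case: h => ->; ring.
apply/eqP; rewrite -subr_eq0 -(mulIr_eq0 _ (mulIf nB)) e z oppr0 //.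
Qed.

Lemma lin_eq_pos (K : fieldType) (x y q : K) : x != 0 ->
  (x * q - y = 0) <-> q = y / x.
Proof.
move=> nx; split=> [/eqP|->]; last by field.
by rewrite subr_eq0 => /eqP <-; field.
Qed.

Lemma lin_eq_neg (K : fieldType) (x y q : K) : x != 0 ->
  (x * q + y = 0) <-> q = - (y / x).
Proof. by move=> nx; rewrite -{1}(opprK y) lin_eq_pos // mulNr. Qed.

Lemma l_eq_factor (b c m B f f' g g' : int) (q : rat) : 0 < b -> 0 < c ->
  B != 0 ->
  f' * g = m * B + B -> f * g' = m * B - B ->
  f' * g' - b * (f * g) = b * c * (m * B) ->
  l (b * c) b q = (1 + m)%:~R <->
  f'%:~R * q - f%:~R = 0 \/ b%:~R * g%:~R * q + g'%:~R = 0.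
Proof.
move=> hb hc nB e1 e2 e3; rewrite l_eq // rmorphD /=.
apply: (quadratic_factor _ _ _ _ B%:~R); first by rewrite intr_eq0.
- by rewrite -!(rmorphM, rmorphD) e1.
- by rewrite -!(rmorphM, rmorphB) e2.
- by rewrite -!(rmorphM, rmorphB) e3.
Qed.

Lemma l_eq_F (b c m : int) (i : nat) (q : rat) : 0 < b -> 0 < c ->
  m * (- b) ^+ i = F (b * c) b i.*2.+1 ->
  l (b * c) b q = (1 + m)%:~R <->
  q = (F (b * c) b i)%:~R / (F (b * c) b i.+1)%:~R
  \/ q = - ((L (b * c) b i.+1)%:~R / (b%:~R * (L (b * c) b i)%:~R)).
Proof.
move=> hb hc hm; have ha : 0 < b * c by rewrite mulr_gt0.
rewrite (l_eq_factor b c m ((- b) ^+ i) (F (b * c) b i) (F (b * c) b i.+1)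
  (L (b * c) b i) (L (b * c) b i.+1)) //.
- rewrite lin_eq_pos ?lin_eq_neg // ?mulf_neq0 // intr_eq0 gt_eqF //.
  + exact: L_pos.
  + exact: F_pos.
- by rewrite expf_neq0 // oppr_eq0 gt_eqF.
- by rewrite hm FL_next.
- by rewrite hm FL_prev.
- by rewrite hm FL_cross.
Qed.

Lemma l_eq_L (b c m : int) (i : nat) (q : rat) : 0 < b -> 0 < c ->
  m * (- b) ^+ i = - F (b * c) b i.*2.+1 ->
  l (b * c) b q = (1 + m)%:~R <->
  q = (L (b * c) b i)%:~R / (L (b * c) b i.+1)%:~R
  \/ (0 < i)%N
    /\ q = - ((F (b * c) b i.+1)%:~R / (b%:~R * (F (b * c) b i)%:~R)).
Proof.
move=> hb hc hm; have ha : 0 < b * c by rewrite mulr_gt0.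
rewrite (l_eq_factor b c m ((- b) ^+ i) (L (b * c) b i) (L (b * c) b i.+1)
  (- F (b * c) b i) (- F (b * c) b i.+1)) //.
- rewrite lin_eq_pos; last by rewrite intr_eq0 gt_eqF // L_pos.
  have -> : b%:~R * (- F (b * c) b i)%:~R * q + (- F (b * c) b i.+1)%:~R
    = - (b%:~R * (F (b * c) b i)%:~R * q + (F (b * c) b i.+1)%:~R) :> rat.
    by rewrite !rmorphN /=; ring.
  (* At [i = 0] the second factor is the nonzero constant [F_1]. *)
  case: i {hm} => [|i].
    split; case; [by left| | by left | by case].
    by rewrite mulr0 mul0r add0r => /eqP; rewrite oppr_eq0 intr_eq0.
  have nF : b%:~R * (F (b * c) b i.+1)%:~R != 0 :> rat.
    by rewrite mulf_neq0 // intr_eq0 gt_eqF // F_pos.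
  split; case=> [h|h]; [by left| | by left | ]; right.
    by split=> //; apply/lin_eq_neg => //; rewrite -[LHS]opprK h oppr0.
  by case: h => _ /lin_eq_neg -> //; rewrite oppr0.
- by rewrite expf_neq0 // oppr_eq0 gt_eqF.
- by have := FL_prev (b * c) b i; rewrite hm; lia.
- by have := FL_next (b * c) b i; rewrite hm; lia.
- by have := FL_cross (b * c) b i; rewrite hm; lia.
Qed.

Theorem theorem1p5 (a b : int) (ha : 0 < a) (hb : 0 < b) (hab : (b %| a)%Z)
    (q : rat) :
  l a b q \is a Num.int <->
  (exists i : nat,
      q = (F a b i)%:~R / (F a b i.+1)%:~R
      \/ q = (L a b i)%:~R / (L a b i.+1)%:~R
      \/ q = - ((L a b i.+1)%:~R / (b%:~R * (L a b i)%:~R)))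
  \/ (exists i : nat,
      (0 < i)%N /\ q = - ((F a b i.+1)%:~R / (b%:~R * (F a b i)%:~R))).
Proof.
case/dvdzP: hab => c ea; rewrite mulrC in ea; subst a.
have hc : 0 < c by move: ha; rewrite pmulr_rgt0.
have wit i : exists m : int, m * (- b) ^+ i = F (b * c) b i.*2.+1.
  have [u [_ [hu _]]] := F_odd_dvd b c i; exists ((-1) ^+ i * u).
  by rewrite (exprNn b) mulrACA -exprMn mulrNN mulr1 expr1n mul1r.
split.
  case/intrP => n hn; have [i hi] := l_int_odd_F b c n q hb hc hn.
  have en : n = 1 + (n - 1) by ring.
  rewrite en in hn; case: hi => hi.
    case/(l_eq_F b c _ i q hb hc hi): hn => hq; left; exists i; tauto.
  case/(l_eq_L b c _ i q hb hc hi): hn => hq; [left|right]; exists i; tauto.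
have intF i : q = (F (b * c) b i)%:~R / (F (b * c) b i.+1)%:~R
    \/ q = - ((L (b * c) b i.+1)%:~R / (b%:~R * (L (b * c) b i)%:~R)) ->
    l (b * c) b q \is a Num.int.
  by have [m hm] := wit i => /(l_eq_F b c m i q hb hc hm) ->.
have intL i : q = (L (b * c) b i)%:~R / (L (b * c) b i.+1)%:~R
    \/ (0 < i)%N
      /\ q = - ((F (b * c) b i.+1)%:~R / (b%:~R * (F (b * c) b i)%:~R)) ->
    l (b * c) b q \is a Num.int.
  have [m hm] := wit i; have hm' : (- m) * (- b) ^+ i = - F (b * c) b i.*2.+1.
    by rewrite mulNr hm.
  by move/(l_eq_L b c _ i q hb hc hm') ->.
by case=> [[i [h|[h|h]]]|[i h]]; [apply: (intF i)|apply: (intL i)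
  |apply: (intF i)|apply: (intL i)]; tauto.
Qed.
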